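(* Let $n$ be a positive integer and let $m$ be any number obtained from $n$ by one Choix de Bruxelles operation. Then $\frac{n}{10} < m < 10n$. Moreover, both bounds are asymptotically sharp: for every $\varepsilon > 0$ there exist a positive integer $n$ and a number $m$ obtained from $n$ by one Choix de Bruxelles operation with $m > (10-\varepsilon) n$, and there exist a positive integer $n'$ and a number $m'$ obtained from $n'$ by one Choix de Bruxelles operation with $m' < (\frac{1}{10}+\varepsilon) n'$.
   Context: The Choix de Bruxelles operation: given a positive integer $n$ with decimal expansion $d_1 d_2 \ldots d_k$, choose indices $1 \le p \le q \le k$ with $d_p \neq 0$, let $s$ be the number with decimal representation $d_p d_{p+1}\ldots d_q$, and replace this substring in situ by the decimal expansion of $2s$, or, if $s$ is even, by the decimal expansion of $s/2$. One may also leave $n$ unchanged (empty substring). For example, $16$ can become any of $16, 26, 13, 112, 8, 32$. *)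

(* Defs.v *)
From mathcomp Require Import all_boot.

Set Implicit Arguments.
Unset Strict Implicit.
Unset Printing Implicit Defensive.

(* Digit sequences are written most significant digit first. *)
Definition digits_value (d : seq nat) : nat :=
  foldl (fun a x => 10 * a + x) 0 d.

(* [d] is the decimal expansion of the positive integer [n]. The default value
   of [head] makes the condition on the leading digit exclude the empty
   sequence. *)
Definition decimal_expansion (n : nat) (d : seq nat) : Prop :=
  [/\ head 0 d != 0, all (fun x => x < 10) d & digits_value d = n].

(* The substring d_p ... d_q is [mid] in a splitting pre ++ mid ++ post; that
   [mid] is the decimal expansion of [s] contains both the condition p <= q and
   the condition d_p != 0. The first disjunct is the choice of the empty
   substring. *)
Definition choix_de_bruxelles (n m : nat) : Prop :=
  m = n \/
  exists (pre mid post : seq nat) (s s' : nat) (mid' : seq nat),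
    [/\ decimal_expansion n (pre ++ mid ++ post),
        decimal_expansion s mid,
        s' = 2 * s \/ ~~ odd s /\ s' = s %/ 2,
        decimal_expansion s' mid' &
        decimal_expansion m (pre ++ mid' ++ post)].

(* Main.v *)
(** Write [n = P 10^(k+l) + s 10^l + r], where [k] is the length of the chosen
    substring. Replacing [s] by [s'] with [s' <= 2 s] lengthens the substring by
    at most one digit, so it multiplies the first term by at most 10 and the
    second by at most 2; as [s > 0] the total grows by a factor less than 10. The
    lower bound is the same fact with the two numbers exchanged, since also
    [s <= 2 s']. Both bounds are approached on [10...05 <-> 10...010]. *)
Require Import Defs.
From mathcomp Require Import all_boot all_order all_algebra.
From mathcomp Require Import reals zify ring lra.

Set Implicit Arguments.
Unset Strict Implicit.
Unset Printing Implicit Defensive.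

Import Order.TTheory GRing.Theory Num.Theory.
Local Open Scope ring_scope.

Lemma digits_value_cat (d e : seq nat) :
  digits_value (d ++ e) = (digits_value d * 10 ^ size e + digits_value e)%N.
Proof.
elim/last_ind: e => [|e x IH]; first by rewrite cats0 muln1 addn0.
rewrite -rcons_cat /digits_value !foldl_rcons -!/(digits_value _) IH size_rcons.
by rewrite expnS; ring.
Qed.

Lemma digits_value_ltn (d : seq nat) :
  all (fun x => x < 10)%N d -> (digits_value d < 10 ^ size d)%N.
Proof.
elim/last_ind: d => [//|d x IH]; rewrite all_rcons => /andP[x_lt /IH].
rewrite /digits_value foldl_rcons -/(digits_value d) size_rcons expnS; lia.
Qed.

Lemma digits_value_geq (d : seq nat) :
  head 0%N d != 0%N -> (10 ^ (size d).-1 <= digits_value d)%N.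
Proof.
case: d => [//|x d] /= x_neq0.
rewrite -cat1s digits_value_cat /digits_value /= -/(digits_value d).
have := expn_gt0 10 (size d); nia.
Qed.

Lemma decimal_expansion_gt0 (n : nat) (d : seq nat) :
  decimal_expansion n d -> (0 < n)%N.
Proof.
by case=> /digits_value_geq d_geq _ <-; apply: leq_trans d_geq; rewrite expn_gt0.
Qed.

(** The nonzero leading digit of [d'] gives [10 ^ (size d').-1 <= s'], while
    [s' <= 2 * s < 2 * 10 ^ size d], which is below [10 ^ (size d).+1]. *)
Lemma decimal_expansion_size_leqS (s s' : nat) (d d' : seq nat) :
  decimal_expansion s d -> decimal_expansion s' d' -> (s' <= 2 * s)%N ->
  (size d' <= (size d).+1)%N.
Proof.
move=> [_ /digits_value_ltn + <-] [/digits_value_geq + _ <-] s'_le.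
move=> s_lt s'_geq.
suff : ((size d').-1 < (size d).+1)%N by lia.
rewrite -(@ltn_exp2l 10) // expnS; lia.
Qed.

Lemma substring_replacement_ltn (s s' : nat) (pre mid mid' post : seq nat) :
  decimal_expansion s mid -> decimal_expansion s' mid' -> (s' <= 2 * s)%N ->
  (digits_value (pre ++ mid' ++ post)
     < 10 * digits_value (pre ++ mid ++ post))%N.
Proof.
move=> smid smid' s'_le; have s_gt0 := decimal_expansion_gt0 smid.
have := decimal_expansion_size_leqS smid smid' s'_le.
case: smid smid' => [_ _ s_def] [_ _ s'_def].
rewrite -(@leq_exp2l 10) // expnS => le_exp.
rewrite !digits_value_cat s_def s'_def !size_cat !expnD.
have l_gt0 := expn_gt0 10 (size post).
(* Strictness comes from this term, as [0 < s]; the prefix term may vanish, so its bound is only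
   weak. *)
have : (s' * 10 ^ size post < 10 * (s * 10 ^ size post))%N by nia.
have : (digits_value pre * (10 ^ size mid' * 10 ^ size post)
  <= 10 * (digits_value pre * (10 ^ size mid * 10 ^ size post)))%N.
  by rewrite !mulnA leq_mul2r [(10 * _)%N]mulnC -mulnA leq_mul2l le_exp !orbT.
lia.
Qed.

Lemma choix_de_bruxelles_ltn (n m : nat) :
  (0 < n)%N -> choix_de_bruxelles n m -> (n < 10 * m)%N /\ (m < 10 * n)%N.
Proof.
move=> n_gt0 [->|]; first by lia.
case=> [pre [mid [post [s [s' [mid' [[_ _ <-] smid s'_eq smid' [_ _ <-]]]]]]]].
(* The lower bound swaps [mid] and [mid'] and needs [s <= 2 * s']: when halving, this rests on [s]
   being even. *)
by split; [apply: (substring_replacement_ltn _ _ smid' smid)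
          |apply: (substring_replacement_ltn _ _ smid smid')];
   case: s'_eq => [->|[]]; lia.
Qed.

Lemma decimal_expansion_one_zeros (k v : nat) (d : seq nat) :
  all (fun x => x < 10)%N d -> digits_value d = v ->
  decimal_expansion (10 ^ (k + size d) + v) ((1%N :: nseq k 0%N) ++ d).
Proof.
move=> d_digits <-; split=> //.
  by rewrite all_cat /= all_nseq orbT.
rewrite digits_value_cat expnD; congr (_ * _ + _)%N.
(* The zero is split off at the right end, where it multiplies the value by 10. *)
elim: k => [//|k IH].
by rewrite -[k.+1]addn1 nseqD -cat_cons digits_value_cat IH expnD addn0.
Qed.

Lemma decimal_expansion_one_zeros_five (k : nat) :
  decimal_expansion (10 ^ k.+1 + 5) ((1%N :: nseq k 0%N) ++ [:: 5]).
Proof. by rewrite -[k.+1]addn1; apply: decimal_expansion_one_zeros. Qed.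

Lemma decimal_expansion_one_zeros_ten (k : nat) :
  decimal_expansion (10 ^ k.+2 + 10) ((1%N :: nseq k 0%N) ++ [:: 1; 0]).
Proof. by rewrite -[k.+2]addn2; apply: decimal_expansion_one_zeros. Qed.

(** Doubling the last digit 5 creates a new digit, which pushes the leading 1 up one place. *)
Lemma choix_de_bruxelles_double_five (k : nat) :
  choix_de_bruxelles (10 ^ k.+1 + 5) (10 ^ k.+2 + 10).
Proof.
right; exists (1%N :: nseq k 0%N), [:: 5], [::], 5, 10, [:: 1; 0].
by split; [exact: decimal_expansion_one_zeros_five | | left |
           | exact: decimal_expansion_one_zeros_ten].
Qed.

Lemma choix_de_bruxelles_halve_ten (k : nat) :
  choix_de_bruxelles (10 ^ k.+2 + 10) (10 ^ k.+1 + 5).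
Proof.
right; exists (1%N :: nseq k 0%N), [:: 1; 0], [::], 10, 5, [:: 5].
by split; [exact: decimal_expansion_one_zeros_ten | | right |
           | exact: decimal_expansion_one_zeros_five].
Qed.

Lemma exists_expn10_gt (R : archiRealFieldType) (x : R) :
  exists k : nat, x < (10 ^ k)%:R.
Proof.
exists (Num.bound `|x|); apply: (le_lt_trans (ler_norm x)).
apply: (lt_trans (archi_boundP (normr_ge0 x))).
by rewrite ltr_nat ltn_expl.
Qed.

Theorem theorem3 (R : realType) :
  (forall n m : nat, (0 < n)%N -> choix_de_bruxelles n m ->
     n%:R / 10%:R < m%:R :> R /\ m%:R < 10%:R * n%:R :> R) /\
  (forall eps : R, 0 < eps ->
     (exists n m : nat, [/\ (0 < n)%N, choix_de_bruxelles n m &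
        (10%:R - eps) * n%:R < m%:R]) /\
     (exists n' m' : nat, [/\ (0 < n')%N, choix_de_bruxelles n' m' &
        m'%:R < (1 / 10%:R + eps) * n'%:R])).
Proof.
split=> [n m n_gt0 /(choix_de_bruxelles_ltn n_gt0)[n_lt m_lt]|eps eps_gt0].
  by rewrite ltr_pdivrMr ?ltr0n // [_%:R * 10%:R]mulrC -!natrM !ltr_nat.
(* With [n = 10 ^ k.+1 + 5] and [m = 10 ^ k.+2 + 10], [10 * n - m = 40], so [40 < eps * n] is what
   the upper bound needs. With the roles exchanged the gap is [n - m / 10 = 4], so the same [k]
   serves. *)
have [k] := exists_expn10_gt (40%:R / eps).
rewrite ltr_pdivrMr // => k_large.
have five_eq : (10 ^ k.+1 + 5)%:R = 10%:R * (10 ^ k)%:R + 5%:R :> R.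
  by rewrite expnS natrD natrM.
have ten_eq : (10 ^ k.+2 + 10)%:R = 100%:R * (10 ^ k)%:R + 10%:R :> R.
  by rewrite !expnS mulnA natrD natrM.
split.
- exists (10 ^ k.+1 + 5)%N, (10 ^ k.+2 + 10)%N.
  split; [by rewrite addnS|exact: choix_de_bruxelles_double_five|].
  rewrite five_eq ten_eq; nra.
- exists (10 ^ k.+2 + 10)%N, (10 ^ k.+1 + 5)%N.
  split; [by rewrite addnS|exact: choix_de_bruxelles_halve_ten|].
  rewrite five_eq ten_eq; nra.
Qed.
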